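(* Any $(q,\varepsilon)$-query algorithm that gives a multiplicative approximation for either \textsc{fas-t} or \textsc{fas-size-t} on $n$-vertex tournaments must make $q=\exp(\Omega(\varepsilon^2 n))$ queries.
   Context: For a digraph $G=(V,E)$ on $n$ vertices and an ordering (bijection) $\sigma\colon V\to[n]$, $B_G(\sigma)=\{(v,u)\in E:\sigma(u)<\sigma(v)\}$ and $\beta_G=\min_\sigma|B_G(\sigma)|$. \textsc{fas-t} ($\alpha$-approx.): for a tournament $G$, output $\sigma$ with $|B_G(\sigma)|\le\alpha\beta_G$; \textsc{fas-size-t} ($\alpha$-approx.): output an integer in $[\beta_G,\alpha\beta_G]$. An $\varepsilon$-oracle for $G$ is one that, on query an ordering $\sigma$, returns some $\hat\beta\in\mathbb{R}$ with $(1-\varepsilon)|B_G(\sigma)|\le\hat\beta\le(1+\varepsilon)|B_G(\sigma)|$. A $(q,\varepsilon)$-query algorithm for a problem accesses the input digraph solely through queries to an (arbitrary) $\varepsilon$-oracle and, after at most $q$ queries, outputs its answer, which must be correct with probability at least $2/3$. *)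

(* Defs.v *)
From HB Require Import structures.
From mathcomp Require Import all_boot all_order all_fingroup all_algebra.
From mathcomp Require Import all_classical all_reals all_analysis.

Set Implicit Arguments.
Unset Strict Implicit.
Unset Printing Implicit Defensive.

Import Order.TTheory GRing.Theory Num.Theory.

Local Open Scope ring_scope.

Definition tournament (n : nat) (G : rel 'I_n) : Prop :=
  irreflexive G /\ forall u v : 'I_n, u != v -> G u v (+) G v u.

(* Orderings of the vertices are permutations s : 'S_n, with ranks 0, ..., n-1. *)
Definition back_arcs (n : nat) (G : rel 'I_n) (s : 'S_n) : {set 'I_n * 'I_n} :=
  [set e : 'I_n * 'I_n | G e.1 e.2 && (s e.2 < s e.1)%N].

Definition fas_size (n : nat) (G : rel 'I_n) : nat :=
  #|back_arcs G [arg min_(s < (1%g : 'S_n)) #|back_arcs G s|]%N|.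

Definition fas_t (R : realType) (n : nat) (alpha : R)
    (G : rel 'I_n) (s : 'S_n) : Prop :=
  #|back_arcs G s|%:R <= alpha * (fas_size G)%:R.

Definition fas_size_t (R : realType) (n : nat) (alpha : R)
    (G : rel 'I_n) (k : int) : Prop :=
  (fas_size G)%:R <= (k%:~R : R) <= alpha * (fas_size G)%:R.

Definition eps_oracle (R : realType) (n : nat) (eps : R) (G : rel 'I_n)
    (O : 'S_n -> R) : Prop :=
  forall s : 'S_n,
    (1 - eps) * #|back_arcs G s|%:R <= O s <= (1 + eps) * #|back_arcs G s|%:R.

(* A deterministic adaptive strategy: the continuation of a query receives the
   real number returned by the oracle. *)
Inductive strategy (R : Type) (n : nat) (out : Type) : Type :=
| Output of out
| Query of 'S_n & (R -> strategy R n out).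

Fixpoint run (R : Type) (n : nat) (out : Type) (O : 'S_n -> R)
    (t : strategy R n out) : out :=
  match t with
  | Output o => o
  | Query s k => run O (k (O s))
  end.

Fixpoint num_queries (R : Type) (n : nat) (out : Type) (O : 'S_n -> R)
    (t : strategy R n out) : nat :=
  match t with
  | Output _ => 0%N
  | Query s k => (num_queries O (k (O s))).+1
  end.

(* A randomized algorithm is a random strategy: w : Omega holds all the coins,
   drawn in advance. The event clause says that, on every admissible input, the
   output is a random variable for the discrete sigma-algebra on [out]. *)
Definition query_algorithm (R : realType) (n : nat) (out : Type)
    (q : nat) (eps : R) (correct : rel 'I_n -> out -> Prop)
    (d : measure_display) (Omega : measurableType d) (P : probability Omega R)
    (alg : Omega -> strategy R n out) : Prop :=
  forall (G : rel 'I_n) (O : 'S_n -> R), tournament G -> eps_oracle eps G O ->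
    [/\ forall w : Omega, (num_queries O (alg w) <= q)%N,
        forall A : set out, measurable [set w | A (run O (alg w))]%classic
      & ((2 / 3)%:E <= P [set w | correct G (run O (alg w))]%classic)%E].

(* Main.v *)
Require Import Defs.
From HB Require Import structures.
From mathcomp Require Import all_boot all_order all_fingroup all_algebra.
From mathcomp Require Import all_classical all_reals all_analysis.
From mathcomp Require Import measurable_realfun.
From mathcomp Require Import zify ring lra.

Set Implicit Arguments.
Unset Strict Implicit.
Unset Printing Implicit Defensive.

Import Order.TTheory GRing.Theory Num.Theory.

Local Open Scope ring_scope.

(* Relabel the vertices of the transitive tournament uniformly at random. Adding
   the vertices one by one, the sink last, shows that the number of back arcs of
   any fixed ordering is a sum of independent uniform variables on [0, j], j < n,
   so it lies within a factor 1 +- eps of its mean 'C(n, 2) / 2 except with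
   probability exp(- Omega(eps ^ 2 * n)). An oracle may thus answer 'C(n, 2) / 2
   (or 0 when eps > 1) to almost all queries, and a strategy that only sees this
   constant outputs a constant. This output is the optimal ordering of only one
   relabeling, and it cannot tell the transitive tournament (beta = 0) from the
   one in which an arc is reversed to create a 3-cycle (beta > 0).
   When eps ^ 2 * n is small this gives no more than q > 0, whereas q >= 2 is
   needed; one query is ruled out separately, with the exact oracle. *)

(** * Back arcs under relabeling and under insertion of a sink *)

(** A relation on all integers supplies graphs of every size at once, which makes induction on the
    number of vertices possible. *)
Definition induced (e : rel nat) (n : nat) : rel 'I_n := fun u v => e u v.

Definition relabel (n : nat) (G : rel 'I_n) (p : 'S_n) : rel 'I_n :=
  fun u v => G (p u) (p v).

(** The vertex [p u] of [G] plays the role of [u], so its rank is [s u], the value of [p^-1 * s] at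
    [p u]. *)
Lemma card_back_arcs_relabel (n : nat) (G : rel 'I_n) (p s : 'S_n) :
  #|back_arcs (relabel G p) s| = #|back_arcs G (p^-1 * s)%g|.
Proof.
pose f (a : 'I_n * 'I_n) := (p a.1, p a.2).
have f_inj : injective f by move=> [a b] [c d] [] /perm_inj -> /perm_inj ->.
rewrite -[RHS](card_preimset _ f_inj); apply: eq_card => -[u v].
by rewrite !inE /f /= !permM !permK.
Qed.

Lemma card_back_arcsE (n : nat) (G : rel 'I_n) (s : 'S_n) :
  #|back_arcs G s| = (\sum_u \sum_v (G u v && (s v < s u)))%N.
Proof.
rewrite -sum1_card big_mkcond pair_bigA /=.
by apply: eq_bigr => -[u v] _; rewrite inE /=; case: ifP.
Qed.

Lemma sum_ltn_ord (n m : nat) : (\sum_(j < n) (m <= j))%N = (n - m)%N.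
Proof.
elim: n => [|n IH]; first by rewrite big_ord0.
by rewrite big_ord_recr /= IH; case: leqP => /=; lia.
Qed.

Lemma widen_ord_lift_max (n : nat) (i : 'I_n) :
  widen_ord (leqnSn n) i = lift ord_max i.
Proof. by apply: val_inj; rewrite /= /bump leqNgt ltn_ord. Qed.

Definition sink (e : rel nat) (n : nat) : Prop :=
  ~~ e n n /\ forall i, (i < n)%N -> e i n && ~~ e n i.

(** With the sink at rank [r], exactly the [n - r] vertices ranked after it send it a back arc;
    [lift r] keeps the relative order of the others. *)
Lemma card_back_arcs_sink (e : rel nat) (n : nat) (r : 'I_n.+1) (s : 'S_n) :
  sink e n ->
  #|back_arcs (@induced e n.+1) (lift_perm ord_max r s)|
    = (n - r + #|back_arcs (@induced e n) s|)%N.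
Proof.
move=> [nn_e n_sink].
rewrite !card_back_arcsE big_ord_recr /= [X in (_ + X)%N]big1 => [|v _]; last first.
  have [->|/eqP v_max] := eqVneq v ord_max; first by rewrite /induced (negbTE nn_e).
  have lt_vn : (v < n)%N.
    by rewrite ltn_neqAle -ltnS ltn_ord andbT; apply/eqP => /(@val_inj _ _ _ v ord_max).
  by case/andP: (n_sink v lt_vn) => _ /negbTE e_nv; rewrite /induced /= e_nv.
rewrite addn0.
under eq_bigr => u _.
  rewrite big_ord_recr /= !widen_ord_lift_max lift_perm_lift lift_perm_id.
  under eq_bigr => v _.
    rewrite widen_ord_lift_max lift_perm_lift /induced !lift_max.
    rewrite (_ : (lift r (s v) < lift r (s u)) = (s v < s u))%N; last first.
      by rewrite !ltnNge /= leq_bump2.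
    over.
  rewrite /induced lift_max; case/andP: (n_sink u (ltn_ord u)) => -> _ /=.
  rewrite (_ : (r < bump r (s u)) = (r <= s u))%N; last first.
    by rewrite /bump; case: leqP; lia.
  over.
rewrite big_split addnC; congr (_ + _)%N.
by rewrite -(sum_ltn_ord n r) [RHS](reindex_inj (@perm_inj _ s)).
Qed.

(** An ordering amounts to the rank of the last vertex and an ordering of the rest, chosen
    independently; the injection is onto by counting. *)
Lemma sum_lift_perm (V : nmodType) (n : nat) (F : 'S_n.+1 -> V) :
  \sum_s F s = \sum_(r < n.+1) \sum_(s : 'S_n) F (lift_perm ord_max r s).
Proof.
rewrite pair_bigA /=.
pose f (a : 'I_n.+1 * 'S_n) := lift_perm ord_max a.1 a.2.
have f_inj : injective f.
  move=> [r s] [r' s'] /permP eq_f.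
  have := eq_f ord_max; rewrite !lift_perm_id => /= eq_r; rewrite -{}eq_r in eq_f *.
  congr (_, _); apply/permP => i.
  by have := eq_f (lift ord_max i); rewrite !lift_perm_lift => /lift_inj.
rewrite (reindex f) //; apply/onW_bij/inj_card_bij => //.
by rewrite card_prod card_ord !card_Sn factS.
Qed.

(** * Exponential moments and concentration of the number of back arcs *)

(** For [|x| >= 1/2] each exponent is at most [2 * x ^+ 2]. For smaller [x], [expR y <= 1 / (1 - y)
    <= 1 + y + 2 * y ^+ 2], and the linear terms cancel. *)
Lemma expR_sym_le (R : realType) (x : R) :
  expR x + expR (- x) <= 2 * expR (2 * x ^+ 2).
Proof.
have [x_ge|x_lt] := lerP (1 / 2) `|x|.
  have le_exp y : `|y| = `|x| -> expR y <= expR (2 * x ^+ 2).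
    move=> y_x; rewrite ler_expR (le_trans (ler_norm y)) // y_x.
    rewrite -(real_normK (num_real x)); move: (`|x|) x_ge => z z_ge; nra.
  by rewrite mulrDl mul1r lerD // le_exp ?normrN.
have exp_le (y : R) : y < 1 / 2 -> - (1 / 2) < y -> expR y <= 1 + y + 2 * y ^+ 2.
  move=> y_lt y_gt; have := expR_ge1Dx (- y); rewrite expRN => h.
  have e_gt0 := expR_gt0 y.
  have : (1 - y) * expR y <= 1.
    by have := ler_wpM2r (ltW e_gt0) h; rewrite mulVf ?lt0r_neq0.
  (* The product equals [1 + y ^+ 2 * (1 - 2 * y)], and [y < 1 / 2]. *)
  have : (1 - y) * (1 + y + 2 * y ^+ 2) >= 1 by nra.
  nra.
move: x_lt; rewrite ltr_norml => /andP[x_gt x_lt].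
have e1 := exp_le x x_lt x_gt.
have e2 : expR (- x) <= 1 - x + 2 * x ^+ 2.
  by have := exp_le (- x); rewrite sqrrN; apply; lra.
have := expR_ge1Dx (2 * x ^+ 2); lra.
Qed.

(* The involution [f] makes [Y] symmetrically distributed, so that [expR] may be
   replaced by its even part. *)
Lemma sum_expR_sym (R : realType) (T : finType) (f : T -> T) (Y : T -> R) (M : R) :
  involutive f -> (forall x, Y (f x) = - Y x) -> (forall x, `|Y x| <= M) ->
  \sum_x expR (Y x) <= #|T|%:R * expR (2 * M ^+ 2).
Proof.
move=> fK Y_odd Y_le.
have sum_opp : \sum_x expR (Y x) = \sum_x expR (- Y x).
  rewrite (reindex_inj (inv_inj fK)); apply: eq_bigr => x _.
  by rewrite Y_odd.
suff : \sum_x expR (Y x) + \sum_x expR (- Y x) <= 2 * (#|T|%:R * expR (2 * M ^+ 2)).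
  by rewrite -sum_opp; lra.
rewrite -big_split /= mulrCA -[#|T|]sum1_card natr_sum mulr_suml.
apply: ler_sum => x _; rewrite mul1r (le_trans (expR_sym_le _)) //.
rewrite ler_wpM2l // ler_expR ler_wpM2l // -(real_normK (num_real (Y x))).
by rewrite ler_pXn2r ?nnegrE // (le_trans _ (Y_le x)).
Qed.

(** A Hoeffding bound for one uniform summand: [rev_ord] reflects it about its mean [n / 2], from
    which it deviates by at most [n / 2]. *)
Lemma sum_expR_uniform (R : realType) (n : nat) (t : R) :
  \sum_(r < n.+1) expR (t * ((n - r)%:R - n%:R / 2))
    <= n.+1%:R * expR (t ^+ 2 * n%:R ^+ 2 / 2).
Proof.
have := @sum_expR_sym R 'I_n.+1 (@rev_ord _)
  (fun r => t * ((n - r)%:R - n%:R / 2)) (`|t| * (n%:R / 2)) rev_ordK.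
rewrite card_ord => /(_ _ _)/le_trans -> // => [r|r|].
- rewrite /= subSS subKn -1?ltnS ?ltn_ord // natrB -1?ltnS ?ltn_ord //.
  lra.
- rewrite normrM ler_wpM2l // natrB -1?ltnS ?ltn_ord // ler_norml.
  have : (r%:R : R) <= n%:R by rewrite ler_nat -ltnS.
  have : (0 : R) <= r%:R by [].
  by move=> *; apply/andP; split; lra.
- rewrite ler_wpM2l // ler_expR exprMn real_normK ?num_real //; lra.
Qed.

Lemma sum_expR_back_arcs (R : realType) (e : rel nat) (n : nat) (t : R) :
  (forall k, (3 <= k)%N -> sink e k) -> (3 <= n)%N ->
  \sum_(s : 'S_n) expR (t * (#|back_arcs (@induced e n) s|%:R - 'C(n, 2)%:R / 2))
    <= n`!%:R * expR (8 * `|t| + t ^+ 2 * n%:R ^+ 3 / 2).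
Proof.
move=> e_sink; elim: n => // n IH; rewrite leq_eqVlt => /orP[/eqP[<-]|n_ge].
  rewrite -(card_Sn 3) -[#|_|]sum1_card natr_sum mulr_suml.
  apply: ler_sum => s _; rewrite mul1r ler_expR.
  have t2 : 0 <= t ^+ 2 * 3 ^+ 3 / 2 by rewrite mulr_ge0 // mulr_ge0 // sqr_ge0.
  rewrite -[leLHS]addr0 lerD // (le_trans (ler_norm _)) // normrM mulrC.
  rewrite ler_wpM2r //.
  (* The trivial bound by 9 pairs suffices: the deviation from 3/2 is at most 15/2, whence the term
     [8 * |t|]. *)
  have := max_card (mem (back_arcs (@induced e 3) s)).
  rewrite card_prod card_ord => b_le.
  have {}b_le : (#|back_arcs (@induced e 3) s|%:R : R) <= 9 by rewrite ler_nat.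
  have : 0 <= (#|back_arcs (@induced e 3) s|%:R : R) by [].
  rewrite (_ : 'C(3, 2) = 3)%N // ler_norml => b_ge.
  by apply/andP; split; lra.
rewrite ltnS in n_ge; rewrite sum_lift_perm.
set m := (X in X <= _).
(* By independence of the rank of the sink and the order of the rest, the exponential moment
   factors. *)
have -> : m = (\sum_(r < n.+1) expR (t * ((n - r)%:R - n%:R / 2))) *
    \sum_(s : 'S_n) expR (t * (#|back_arcs (@induced e n) s|%:R - 'C(n, 2)%:R / 2)).
  rewrite big_distrl; apply: eq_bigr => r _; rewrite big_distrr.
  apply: eq_bigr => s _ /=; rewrite card_back_arcs_sink; last exact: e_sink.
  by rewrite -expRD binS bin1 !natrD; congr expR; lra.
apply: (le_trans (ler_pM _ _ (sum_expR_uniform _ _) (IH n_ge))).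
- by apply: sumr_ge0 => *; exact: expR_ge0.
- by apply: sumr_ge0 => *; exact: expR_ge0.
rewrite mulrACA -natrM -factS -expRD ler_wpM2l // ler_expR -[n.+1%:R]natr1.
have := sqr_ge0 t; have : (0 : R) <= n%:R by [].
move: (n%:R : R) (t ^+ 2) => a b a0 b0.
(* The second factor is the slack [(a + 1) ^+ 3 - a ^+ 3 - a ^+ 2]. *)
have : 0 <= b * (1 + 3 * a + 2 * a ^+ 2) by rewrite mulr_ge0 //; nra.
rewrite addrCA lerD2l; lra.
Qed.

Lemma leq_sqr_bin2 (n : nat) : (2 <= n)%N -> (n ^ 2 <= 4 * 'C(n, 2))%N.
Proof.
elim: n => // n IH; rewrite leq_eqVlt => /orP[/eqP[<-] //|n_ge].
by rewrite binS bin1 mulnDr; have := IH n_ge; rewrite -!mulnn; nia.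
Qed.

Definition admissible (R : realType) (eps a b : R) : bool :=
  (1 - eps) * b <= a <= (1 + eps) * b.

(** If [b >= N / 4], a failed relative bound means a deviation above [eps * b]; if [b < N / 4], the
    deviation exceeds [N / 4], and [eps <= 1]. *)
Lemma inadmissible_far (R : realType) (eps b N : R) :
  0 <= eps -> eps <= 1 -> 0 <= b -> ~~ admissible eps (N / 2) b ->
  eps * N / 4 <= `|b - N / 2|.
Proof.
move=> e0 e1 b0; rewrite negb_and -!ltNge ler_normr => /orP[h|h].
  by apply/orP; left; nra.
apply/orP; right; have [bN|Nb] := lerP (N / 4) b; nra.
Qed.

(** Chernoff's method on both tails, at deviation [eps * N / 4] with [N] of order [n ^ 2]. *)
Lemma sum_inadmissible (R : realType) (e : rel nat) (n : nat) (eps : R) :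
  (forall k, (3 <= k)%N -> sink e k) -> (3 <= n)%N -> 0 <= eps -> eps <= 1 ->
  (\sum_(s : 'S_n)
    ~~ admissible eps ('C(n, 2)%:R / 2) #|back_arcs (@induced e n) s|%:R)%:R
    <= 4 * n`!%:R * expR (- (eps ^+ 2 * n%:R / 512)).
Proof.
move=> e_sink n_ge e0 e1.
(* This [t] makes the gain [D] at least [eps ^+ 2 * n / 256], twice the loss
   [t ^+ 2 * n ^+ 3 / 2]. *)
pose t : R := eps / (16 * n%:R); pose N : R := 'C(n, 2)%:R.
pose b (s : 'S_n) : R := #|back_arcs (@induced e n) s|%:R.
have n_ge3 : 3 <= n%:R :> R by rewrite ler_nat.
have n_neq0 : n%:R != 0 :> R by rewrite gt_eqF //; lra.
have tn : t * n%:R = eps / 16 by rewrite /t; field.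
have t_ge0 : 0 <= t by rewrite divr_ge0 // mulr_ge0.
have N_ge : n%:R ^+ 2 <= 4 * N by rewrite -natrX -natrM ler_nat leq_sqr_bin2 // ltnW.
pose D := t * (eps * N / 4).
pose E := expR (8 * t + t ^+ 2 * n%:R ^+ 3 / 2).
have markov : (\sum_s ~~ admissible eps (N / 2) (b s))%:R
    <= expR (- D) * (\sum_s expR (t * (b s - N / 2)) + \sum_s expR ((- t) * (b s - N / 2))).
  rewrite natr_sum -big_split mulr_sumr; apply: ler_sum => s _ /=.
  case: (boolP (admissible _ _ _)) => [_|bad] /=.
    by rewrite mulr_ge0 ?addr_ge0 ?expR_ge0.
  have {bad} := inadmissible_far e0 e1 (ler0n _ _) bad; rewrite -/(b s) => far.
  rewrite mulrDr -!expRD; set y := b s - N / 2 in far *.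
  have y1 := expR_ge0 (- D + t * y); have y2 := expR_ge0 (- D + - t * y).
  move: far; rewrite ler_normr => /orP[far|far].
    have : 1 <= expR (- D + t * y) by rewrite -expR0 ler_expR /D addrC subr_ge0 ler_wpM2l.
    lra.
  have : 1 <= expR (- D + - t * y).
    by rewrite -expR0 ler_expR /D addrC subr_ge0 mulNr -mulrN ler_wpM2l.
  lra.
apply: (le_trans markov).
have m1 := sum_expR_back_arcs t e_sink n_ge.
have m2 := sum_expR_back_arcs (- t) e_sink n_ge.
rewrite sqrrN normrN in m2; rewrite ger0_norm // -/E in m1 m2.
apply: (@le_trans _ _ (expR (- D) * (n`!%:R * E + n`!%:R * E))).
  by rewrite ler_wpM2l ?expR_ge0 // lerD.
have -> : expR (- D) * (n`!%:R * E + n`!%:R * E) = 2 * n`!%:R * (expR (- D) * E) by ring.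
have -> : 4 * n`!%:R * expR (- (eps ^+ 2 * n%:R / 512))
    = 2 * n`!%:R * (2 * expR (- (eps ^+ 2 * n%:R / 512))) :> R by ring.
rewrite ler_wpM2l // -expRD.
(* The remaining term [8 * t = eps / (2 * n)] is at most 1/6, as [n >= 3]. *)
have exp_half : expR (1 / 6 : R) <= 2.
  have := expR_ge1Dx (- (1 / 6) : R); rewrite expRN => h.
  have := ler_wpM2r (ltW (expR_gt0 (1 / 6 : R))) h.
  by rewrite mulVf ?lt0r_neq0 ?expR_gt0 // => h'; lra.
apply: (@le_trans _ _ (expR (1 / 6) * expR (- (eps ^+ 2 * n%:R / 512)))); last first.
  exact: (ler_wpM2r (expR_ge0 _) exp_half).
rewrite -expRD ler_expR.
have D_ge : eps ^+ 2 * n%:R / 256 <= D.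
  have -> : eps ^+ 2 * n%:R / 256 = t * (eps * (n%:R ^+ 2 / 4) / 4).
    have -> : eps ^+ 2 * n%:R / 256 = (eps / 16) * (eps * n%:R / 16) by field.
    by rewrite -tn; field.
  rewrite ler_wpM2l // ler_wpM2r // ler_wpM2l //; lra.
have -> : t ^+ 2 * n%:R ^+ 3 / 2 = (t * n%:R) ^+ 2 * n%:R / 2 by ring.
by rewrite tn; nra.
Qed.

(** * The two hard tournaments and their optima *)

(* [arcs false] is the transitive tournament on the integers; [arcs true] also
   reverses the arc (0, 2), which creates the 3-cycle 0 -> 1 -> 2 -> 0. *)
Definition arcs (flip : bool) : rel nat := fun i j =>
  ((i < j) (+) (flip && (((i, j) == (0, 2)) || ((i, j) == (2, 0)))))%N.

Lemma sink_arcs (flip : bool) (k : nat) : (3 <= k)%N -> sink (arcs flip) k.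
Proof.
move=> k_ge; split=> [|i lt_ik]; rewrite /arcs !xpair_eqE; first by lia.
by case: flip; lia.
Qed.

Lemma tournament_arcs (flip : bool) (n : nat) (p : 'S_n) :
  tournament (relabel (@induced (arcs flip) n) p).
Proof.
split=> [u|u v uv]; rewrite /relabel /induced /arcs !xpair_eqE.
  by rewrite ltnn; case: flip => //=; lia.
have : nat_of_ord (p u) != p v by apply: contra uv => /eqP/val_inj/perm_inj ->.
by case: flip => /=; lia.
Qed.

Lemma card_back_arcs_flip (f f' : bool) (n : nat) (s : 'S_n) :
  (#|back_arcs (@induced (arcs f) n) s|
    <= #|back_arcs (@induced (arcs f') n) s| + 2)%N.
Proof.
pose flipped : pred ('I_n * 'I_n) := fun a =>
  (((a.1 : nat, a.2 : nat) == (0, 2)) || ((a.1 : nat, a.2 : nat) == (2, 0)))%N.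
have flipped_le : (#|flipped| <= 2)%N.
  pose nats (a : 'I_n * 'I_n) := (a.1 : nat, a.2 : nat).
  have nats_inj : injective nats by move=> [a b] [c d] [] /val_inj -> /val_inj ->.
  rewrite cardE -(size_map nats) -[leqRHS]/(size [:: (0, 2); (2, 0)]%N).
  apply: uniq_leq_size; first by rewrite map_inj_uniq // enum_uniq.
  by move=> x /mapP[a]; rewrite mem_enum !inE => h ->.
apply: leq_trans (leq_add (leqnn _) flipped_le).
rewrite -cardUI; apply: leq_trans (leq_addr _ _).
apply: subset_leq_card; apply/fintype.subsetP => -[u v].
rewrite !inE /= /induced /arcs unfold_in /flipped /=.
by do 2!case: (_ == _); rewrite ?orbT ?andbF ?addbF ?orbF.
Qed.

Lemma back_arcs_transitive1 (n : nat) :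
  #|back_arcs (@induced (arcs false) n) 1| = 0%N.
Proof.
apply: eq_card0 => -[u v]; rewrite !inE /= !perm1 /induced /arcs /=.
by rewrite addbF; lia.
Qed.

(** Without back arcs [s] is increasing, and the identity is the only increasing permutation of
    ['I_n]. *)
Lemma back_arcs_transitive_eq0 (n : nat) (s : 'S_n) :
  #|back_arcs (@induced (arcs false) n) s| = 0%N -> s = 1%g.
Proof.
move=> /card0_eq s_back.
have s_mono (u v : 'I_n) : (u < v)%N -> (s u < s v)%N.
  move=> uv; rewrite ltn_neqAle leqNgt; apply/andP; split.
    by apply/eqP => /val_inj/perm_inj uv'; rewrite uv' ltnn in uv.
  by have := s_back (u, v); rewrite !inE /= /induced /arcs /= addbF uv => /= ->.
(* Used for [s] and for its inverse, this yields the two inequalities between [s u] and [u]. *)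
have ge_id (f : 'I_n -> 'I_n) : (forall u v : 'I_n, u < v -> f u < f v)%N ->
    forall u : 'I_n, (u <= f u)%N.
  move=> f_mono [m]; elim: m => //= m IH lt_m.
  by apply: leq_ltn_trans (IH (ltnW lt_m)) _; apply: f_mono => /=.
apply/permP => u; rewrite perm1; apply: val_inj; apply/eqP.
rewrite eqn_leq (ge_id s s_mono) andbT.
have := ge_id (s^-1)%g _ (s u); rewrite permK; apply => x y.
apply: contraTT; rewrite -!leqNgt => le_s.
rewrite -(permKV s x) -(permKV s y) leq_eqVlt orbC.
by move: le_s; rewrite leq_eqVlt => /orP[/eqP/val_inj ->|/s_mono ->]; rewrite ?eqxx ?orbT.
Qed.

(** No ordering respects all three arcs of the cycle 0 -> 1 -> 2 -> 0. *)
Lemma back_arcs_flip_gt0 (n : nat) (s : 'S_n) :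
  (3 <= n)%N -> (0 < #|back_arcs (@induced (arcs true) n) s|)%N.
Proof.
case: n s => [|[|[|n]]] // s _; rewrite card_gt0.
pose x := @inord n.+2 0; pose y := @inord n.+2 1; pose z := @inord n.+2 2.
suff : [|| (x, y) \in back_arcs (@induced (arcs true) n.+3) s,
    (y, z) \in back_arcs (@induced (arcs true) n.+3) s
  | (z, x) \in back_arcs (@induced (arcs true) n.+3) s].
  by case/or3P => h; apply/set0Pn; eexists; exact: h.
have : s z != s x by rewrite (inj_eq perm_inj) -val_eqE /= !inordK.
by rewrite -val_eqE !inE /= /induced !inordK //= /arcs /=; lia.
Qed.

Lemma leq_fas_size (n : nat) (G : rel 'I_n) (s : 'S_n) :
  (fas_size G <= #|back_arcs G s|)%N.
Proof. by rewrite /fas_size; case: arg_minnP => // i _; apply. Qed.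

Lemma fas_size_transitive (n : nat) (p : 'S_n) :
  fas_size (relabel (@induced (arcs false) n) p) = 0%N.
Proof.
apply/eqP; rewrite -leqn0 -(back_arcs_transitive1 n) -(mulVg p).
by rewrite -card_back_arcs_relabel leq_fas_size.
Qed.

Lemma fas_size_flip_gt0 (n : nat) (p : 'S_n) :
  (3 <= n)%N -> (0 < fas_size (relabel (@induced (arcs true) n) p))%N.
Proof. by move=> n_ge; rewrite /fas_size card_back_arcs_relabel back_arcs_flip_gt0. Qed.

(** A multiplicative guarantee on optimum 0 forces optimality, whatever [alpha] is; a correct output
    thus reveals the relabeling. *)
Lemma fas_t_transitive (R : realType) (n : nat) (alpha : R) (p s : 'S_n) :
  fas_t alpha (relabel (@induced (arcs false) n) p) s -> p = s.
Proof.
rewrite /fas_t fas_size_transitive mulr0 lern0 card_back_arcs_relabel.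
by move=> /eqP/back_arcs_transitive_eq0 ps; apply: (mulgI p^-1%g); rewrite mulVg ps.
Qed.

(** A correct size is 0 exactly when the optimum is 0, so it tells the two tournaments apart. *)
Lemma fas_size_t_arcs (R : realType) (n : nat) (alpha : R) (f : bool)
    (p : 'S_n) (k : int) :
  (3 <= n)%N -> fas_size_t alpha (relabel (@induced (arcs f) n) p) k ->
  (k == 0) = ~~ f.
Proof.
move=> n_ge; rewrite /fas_size_t; case: f => /andP[].
  move=> le_k _; apply/negbTE/eqP => k0; move: le_k.
  by rewrite k0 lern0 eqn0Ngt fas_size_flip_gt0.
rewrite fas_size_transitive mulr0 => ? ?; have : (k%:~R : R) = 0 by lra.
by move/eqP; rewrite intr_eq0.
Qed.

(** * Fixing the coins of a randomized algorithm *)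

(** Averaging: the expected number of events that occur is at least two thirds of [#|I|]. *)
Lemma exists_often (R : realType) (d : measure_display) (Omega : measurableType d)
    (P : probability Omega R) (I : finType) (A : I -> set Omega) :
  (forall i, measurable (A i)) -> (forall i, (2 / 3)%:E <= P (A i))%E ->
  exists w, (2 * #|I| <= 3 * \sum_i (w \in A i))%N.
Proof.
move=> A_meas P_ge; apply: contrapT => /forallNP few.
pose m := ((2 * #|I|).-1 %/ 3)%N.
have count_le w : (\sum_i (w \in A i) <= m)%N.
  by have := few w; rewrite /m => /negP; lia.
have m_lt : (3 * m < 2 * #|I|)%N.
  (* A sample point exists because the total mass is 1; with [few] it shows [0 < #|I|], so that the
     predecessor in [m] is a true one. *)
  have /set0P[w _] : [set: Omega]%classic != set0.
    apply/eqP => Omega0; have := probability_setT P.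
    by rewrite Omega0 measure0 => /eqP; rewrite eq_sym onee_eq0.
  by have := few w => /negP; rewrite /m; lia.
have sum_le : (\sum_i P (A i) <= m%:R%:E)%E.
  have -> : (\sum_i P (A i) = \int[P]_w \sum_i (\1_(A i) w)%:E)%E.
    rewrite ge0_integral_sum //; last first.
      by move=> i; apply/measurable_EFinP; exact: measurable_indic.
    by apply: eq_bigr => i _; rewrite integral_indic // setIT.
  rewrite -[leRHS]mule1 -(probability_setT P) -integral_cst //.
  apply: ge0_le_integral => //.
  - by move=> w _; apply: sume_ge0 => i _; rewrite lee_fin.
  - apply: emeasurable_sum => i; apply/measurable_EFinP; exact: measurable_indic.
  - move=> w _; rewrite sumEFin lee_fin.
    under eq_bigr => i _ do rewrite indicE.
    by rewrite -natr_sum ler_nat.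
have : ((\sum_(i : I) (2 / 3 : R))%:E <= m%:R%:E :> \bar R)%E.
  by apply: le_trans sum_le; rewrite -sumEFin; apply: lee_sum => i _.
rewrite lee_fin sumr_const -[_ *+ _]mulr_natr => h.
move: m_lt; rewrite -(ltr_nat R) !natrM; lra.
Qed.

(** The averaging half of Yao's principle, for the uniform distribution on the inputs indexed by
    [I]. *)
Lemma derandomize (R : realType) (n : nat) (out : Type) (q : nat) (eps : R)
    (correct : rel 'I_n -> out -> Prop) (d : measure_display)
    (Omega : measurableType d) (P : probability Omega R)
    (alg : Omega -> strategy R n out)
    (I : finType) (G : I -> rel 'I_n) (O : I -> 'S_n -> R) :
  query_algorithm q eps correct P alg ->
  (forall i, tournament (G i)) -> (forall i, eps_oracle eps (G i) (O i)) ->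
  exists t, (forall i, num_queries (O i) t <= q)%N /\
    (2 * #|I| <= 3 * \sum_i `[< correct (G i) (run (O i) t) >])%N.
Proof.
move=> alg_ok G_tour O_ok.
pose A i := [set w | correct (G i) (run (O i) (alg w))]%classic.
have [w w_ok] : exists w, (2 * #|I| <= 3 * \sum_i (w \in A i))%N.
  apply: (@exists_often _ _ _ P) => i.
    by have [_ /(_ [set o | correct (G i) o]%classic)] := alg_ok _ _ (G_tour i) (O_ok i).
  by have [] := alg_ok _ _ (G_tour i) (O_ok i).
exists (alg w); split=> [i|]; first by have [] := alg_ok _ _ (G_tour i) (O_ok i).
apply: leq_trans w_ok _; rewrite leq_mul2l /=; apply: leq_sum => i _.
by case: (boolP (w \in A i)) => // /set_mem ok; rewrite asboolT.
Qed.

(** * Strategies that see constant answers or a single answer *)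

(** The cut at [q] is needed because constant answers need not come from an admissible oracle, so
    the query budget may fail on this branch. *)
Fixpoint constant_queries (R : Type) (n : nat) (out : Type) (a : R) (q : nat)
    (t : strategy R n out) : seq 'S_n :=
  match q, t with
  | q'.+1, Query s k => s :: constant_queries a q' (k a)
  | _, _ => [::]
  end.

Lemma size_constant_queries (R : Type) (n : nat) (out : Type) (a : R) (q : nat)
    (t : strategy R n out) :
  (size (constant_queries a q t) <= q)%N.
Proof. by elim: q t => [|q IH] [x|s k] //=; rewrite ltnS. Qed.

Lemma run_constant (R : realType) (n : nat) (out : Type) (a : R) (q : nat)
    (O : 'S_n -> R) (t : strategy R n out) :
  (num_queries O t <= q)%N -> all (fun s => O s == a) (constant_queries a q t) ->
  run O t = run (fun=> a) t.
Proof.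
elim: q t => [|q IH] [x|s k] //=; rewrite ltnS => nq /andP[/eqP Os].
by rewrite Os in nq *; exact: IH.
Qed.

(** Union bound: a run can leave the constant branch only if one of its at most [q] queries is not
    answered [a], and each query has at most [K] such indices. *)
Lemma count_run_constant (R : realType) (n : nat) (out : Type) (a K : R) (q : nat)
    (I : finType) (O : I -> 'S_n -> R) (Q : I -> pred out) (t : strategy R n out) :
  (forall i, num_queries (O i) t <= q)%N ->
  (forall s, (\sum_i (O i s != a))%:R <= K) ->
  (\sum_i Q i (run (O i) t))%:R
    <= (\sum_i Q i (run (fun=> a) t))%:R + q%:R * K.
Proof.
move=> nq few.
pose qs := constant_queries a q t.
have le1 : (\sum_i Q i (run (O i) t)
    <= \sum_i Q i (run (fun=> a) t) + \sum_(s <- qs) \sum_i (O i s != a))%N.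
  rewrite exchange_big -big_split; apply: leq_sum => i _ /=.
  have [const|] := boolP (all (fun s => O i s == a) qs).
    by rewrite (run_constant (nq i) const) leq_addr.
  rewrite -has_predC => /hasP[s s_qs Os].
  rewrite (big_rem s) //= -[_ != a]/(predC (fun s => O i s == a) s) Os.
  by rewrite addnCA; apply: leq_trans (leq_b1 _) _.
have K_ge0 : 0 <= K by apply: le_trans (few 1%g).
apply: (@le_trans _ _ (\sum_i Q i (run (fun=> a) t) + \sum_(s <- qs) \sum_i (O i s != a))%N%:R).
  by rewrite ler_nat.
rewrite natrD lerD2l natr_sum.
apply: (@le_trans _ _ (\sum_(s <- qs) K)); first exact: ler_sum.
rewrite big_const_seq count_predT iter_addr addr0 -[K *+ _]mulr_natl ler_wpM2r //.
by rewrite ler_nat size_constant_queries.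
Qed.

Lemma run_one_query (R : realType) (n : nat) (out : Type) (I : Type)
    (O : I -> 'S_n -> R) (t : strategy R n out) :
  (forall i, num_queries (O i) t <= 1)%N ->
  exists s g, forall i, run (O i) t = g (O i s).
Proof.
case: t => [x|s k] nq; first by exists 1%g, (fun=> x).
(* On every answer that occurs [k x] is already an output; the zero oracle is a default value. *)
exists s, (fun x => run (fun=> 0) (k x)) => i /=.
by have := nq i; rewrite /= ltnS leqn0; case: (k _).
Qed.

(** * Uniform relabelings and the lazy oracle *)

(** For fixed [s], [p^-1 * s] runs over all orderings: a fixed query on a random relabeling acts as
    a random ordering of [G]. *)
Lemma sum_relabel (n : nat) (G : rel 'I_n) (F : nat -> nat) (s : 'S_n) :
  (\sum_p F #|back_arcs (relabel G p) s| = \sum_p F #|back_arcs G p|)%N.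
Proof.
have inj : injective (fun p : 'S_n => p^-1 * s)%g by move=> p p' /mulIg/invg_inj.
rewrite [RHS](reindex_inj inj); apply: eq_bigr => p _.
by rewrite card_back_arcs_relabel.
Qed.

(** The answer [a] is given whenever it is legal, so as to reveal as little as possible. *)
Definition lazy_oracle (R : realType) (eps a : R) (n : nat) (G : rel 'I_n)
    (s : 'S_n) : R :=
  if admissible eps a #|back_arcs G s|%:R then a else #|back_arcs G s|%:R.

Lemma exact_eps_oracle (R : realType) (eps : R) (n : nat) (G : rel 'I_n) :
  0 <= eps -> eps_oracle eps G (fun s => #|back_arcs G s|%:R).
Proof.
move=> e0 s; have : 0 <= #|back_arcs G s|%:R :> R by [].
by move: #|_|%:R => b b0; apply/andP; split; nra.
Qed.

Lemma lazy_eps_oracle (R : realType) (eps a : R) (n : nat) (G : rel 'I_n) :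
  0 <= eps -> eps_oracle eps G (lazy_oracle eps a G).
Proof.
by move=> e0 s; rewrite /lazy_oracle; case: ifP => // _; apply: exact_eps_oracle.
Qed.

Lemma sum_lazy_oracle_neq (R : realType) (eps a : R) (n : nat) (G : rel 'I_n)
    (s : 'S_n) :
  (\sum_p (lazy_oracle eps a (relabel G p) s != a)
    <= \sum_p ~~ admissible eps a #|back_arcs G p|%:R)%N.
Proof.
rewrite -(sum_relabel G (fun b => ~~ admissible eps a b%:R) s).
apply: leq_sum => p _; rewrite /lazy_oracle.
by case: ifP => _; rewrite ?eqxx ?leq_b1.
Qed.

(** * What one exact count reveals about the flipped arc *)

Lemma count_iotaE (h : pred nat) (b m : nat) :
  count h (iota b m) = (\sum_(r < m) h (b + r))%N.
Proof.
elim: m => [|m IH]; first by rewrite big_ord0.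
by rewrite -[in LHS]addn1 iotaD count_cat IH big_ord_recr /= addn0.
Qed.

(** Both windows lie in an interval that exceeds each of them by at most [d] points. *)
Lemma count_iota_shift (h : pred nat) (m b c d : nat) :
  (b <= c + d)%N -> (c <= b + d)%N ->
  (count h (iota b m) <= count h (iota c m) + d)%N.
Proof.
have size_le x k : (count h (iota x k) <= k)%N.
  by rewrite -[leqRHS](size_iota x) count_size.
move=> b_le c_le; have [bc|/ltnW cb] := leqP b c.
- have := congr1 (count h) (iotaD b (c - b) m).
  have := congr1 (count h) (iotaD b m (c - b)).
  rewrite addnC => ->; rewrite !count_cat subnKC // => eq_count.
  by have := size_le b (c - b)%N; lia.
- have := congr1 (count h) (iotaD c (b - c) m).
  have := congr1 (count h) (iotaD c m (b - c)).
  rewrite addnC => ->; rewrite !count_cat subnKC // => eq_count.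
  by have := size_le (c + m)%N (b - c)%N; lia.
Qed.

(* Given the order of the other vertices, the position of the sink makes the
   number of back arcs uniform on an interval of length n.+1, and the two
   intervals arising from [arcs false] and [arcs true] are shifted by at most 2. *)
Lemma sum_back_arcs_flip (h : pred nat) (n : nat) : (3 <= n)%N ->
  (\sum_(s : 'S_n.+1) h #|back_arcs (@induced (arcs false) n.+1) s|
    + \sum_(s : 'S_n.+1) ~~ h #|back_arcs (@induced (arcs true) n.+1) s|
    <= n`! * (n + 3))%N.
Proof.
move=> n_ge.
have uniform (g : pred nat) f : (\sum_(s : 'S_n.+1) g #|back_arcs (@induced (arcs f) n.+1) s|
    = \sum_(s : 'S_n) count g (iota #|back_arcs (@induced (arcs f) n) s| n.+1))%N.
  rewrite sum_lift_perm exchange_big; apply: eq_bigr => s _.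
  rewrite count_iotaE [RHS](reindex_inj rev_ord_inj); apply: eq_bigr => r _ /=.
  rewrite card_back_arcs_sink; last exact: sink_arcs.
  by rewrite /= subSS addnC.
rewrite uniform (uniform (predC h)) -big_split -(card_Sn n) -[#|_|]sum1_card big_distrl.
apply: leq_sum => s _; rewrite [leqRHS]mul1n.
set b := #|_|; set c := #|_|.
have := count_iota_shift h n.+1 (card_back_arcs_flip false true s)
  (card_back_arcs_flip true false s).
(* On one window [h] and its complement count [n.+1] in total; the shift adds at most 2. *)
have := count_predC h (iota c n.+1); rewrite size_iota -/b -/c.
by move: (count h (iota b _)) (count h (iota c _)) (count (predC h) _) => x y z /=; lia.
Qed.

(** * Lower bounds on the number of queries *)

Lemma fas_t_lazy_bound (R : realType) (n q : nat) (eps alpha a K : R)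
    (d : measure_display) (Omega : measurableType d) (P : probability Omega R)
    (alg : Omega -> strategy R n 'S_n) :
  (7 <= n)%N -> 0 <= eps -> query_algorithm q eps (fas_t alpha) P alg ->
  (forall f, (\sum_(s : 'S_n)
    ~~ admissible eps a #|back_arcs (@induced (arcs f) n) s|%:R)%:R <= K) ->
  n`!%:R <= 6 * (q%:R * K).
Proof.
move=> n_ge eps_ge0 alg_ok few.
pose G p := relabel (@induced (arcs false) n) p.
have [t [t_q t_ok]] := derandomize alg_ok (tournament_arcs false (n := n))
  (fun p => lazy_eps_oracle a (G p) eps_ge0).
pose Q p o := `[< fas_t alpha (G p) o >].
have few' s : (\sum_p (lazy_oracle eps a (G p) s != a))%:R <= K.
  by apply: le_trans (few false); rewrite ler_nat sum_lazy_oracle_neq.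
have := count_run_constant Q t_q few'.
set o := run _ t => ub.
have Q_le : (\sum_p Q p o <= 1)%N.
  apply: (@leq_trans (\sum_p (p == o))); last first.
    by rewrite (bigD1 o) //= eqxx big1 // => p /negbTE ->.
  apply: leq_sum => p _.
  by rewrite /Q; case: asboolP => // /fas_t_transitive ->; rewrite eqxx.
have fact_ge : (6 <= n`!)%N by rewrite (leq_trans _ (fact_geq n)) // ltnW.
move: t_ok Q_le fact_ge ub.
rewrite card_Sn -!(ler_nat R) !natrM /Q /G; lra.
Qed.

(** For each relabeling a constant is right for at most one of the two tournaments. Hence [4 * n]!
    <= 3 * (n[! + 2 * q * K)], which gives the factor 6. *)
Lemma fas_size_t_lazy_bound (R : realType) (n q : nat) (eps alpha a K : R)
    (d : measure_display) (Omega : measurableType d) (P : probability Omega R)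
    (alg : Omega -> strategy R n int) :
  (7 <= n)%N -> 0 <= eps -> query_algorithm q eps (fas_size_t alpha) P alg ->
  (forall f, (\sum_(s : 'S_n)
    ~~ admissible eps a #|back_arcs (@induced (arcs f) n) s|%:R)%:R <= K) ->
  n`!%:R <= 6 * (q%:R * K).
Proof.
move=> n_ge eps_ge0 alg_ok few.
pose G (i : bool * 'S_n) := relabel (@induced (arcs i.1) n) i.2.
have [t [t_q t_ok]] := derandomize alg_ok
  (fun i : bool * 'S_n => tournament_arcs i.1 i.2)
  (fun i => lazy_eps_oracle a (G i) eps_ge0).
pose Q i k := `[< fas_size_t alpha (G i) k >].
have few' s : (\sum_i (lazy_oracle eps a (G i) s != a))%:R <= K + K.
  rewrite -(pair_bigA _ (fun f p => nat_of_bool (lazy_oracle eps a (G (f, p)) s != a))).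
  rewrite big_bool natrD lerD //.
    by apply: le_trans (few true); rewrite ler_nat sum_lazy_oracle_neq.
  by apply: le_trans (few false); rewrite ler_nat sum_lazy_oracle_neq.
have := count_run_constant Q t_q few'.
set k := run _ t => ub.
have Q_le : (\sum_i Q i k <= n`!)%N.
  rewrite -(pair_bigA _ (fun f p => nat_of_bool (Q (f, p) k))) big_bool -big_split.
  rewrite -(card_Sn n) -[#|_|]sum1_card; apply: leq_sum => p _ /=.
  rewrite /Q; case: asboolP => [/fas_size_t_arcs k_true|_]; last exact: leq_b1.
  case: asboolP => // /fas_size_t_arcs k_false.
  have n_ge3 : (3 <= n)%N by apply: leq_trans n_ge.
  by have := k_false n_ge3; rewrite k_true.
move: t_ok Q_le ub.
rewrite card_prod card_bool card_Sn -!(ler_nat R) !natrM /Q /G; lra.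
Qed.

(** One exact count takes at most [n ^ 2 + 1] values, hence allows at most that many outputs, each
    right for a single relabeling. *)
Lemma fas_t_two_queries (R : realType) (n q : nat) (eps alpha : R)
    (d : measure_display) (Omega : measurableType d) (P : probability Omega R)
    (alg : Omega -> strategy R n 'S_n) :
  (7 <= n)%N -> 0 <= eps -> query_algorithm q eps (fas_t alpha) P alg ->
  (2 <= q)%N.
Proof.
move=> n_ge eps_ge0 alg_ok; rewrite leqNgt ltnS; apply/negP => q_le1.
pose G p := relabel (@induced (arcs false) n) p.
have [t [t_q t_ok]] := derandomize alg_ok (tournament_arcs false (n := n))
  (fun p => exact_eps_oracle (G p) eps_ge0).
have [s [g run_g]] := run_one_query (fun p => leq_trans (t_q p) q_le1).
pose answer (b : 'I_(n ^ 2).+1) := g b%:R.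
have few : (\sum_p `[< fas_t alpha (G p) (run (fun s => #|back_arcs (G p) s|%:R) t) >]
    <= (n ^ 2).+1)%N.
  rewrite -[leqRHS]card_ord; apply: leq_trans (leq_imset_card answer _).
  rewrite -[leqRHS]sum1_card [leqRHS]big_mkcond; apply: leq_sum => p _.
  case: asboolP => [|_ //]; rewrite run_g => /fas_t_transitive {1}->.
  have b_lt : (#|back_arcs (G p) s| < (n ^ 2).+1)%N.
    by rewrite ltnS (leq_trans (max_card _)) // card_prod card_ord mulnn.
  by rewrite (_ : _ \in _) //; apply/imsetP; exists (Ordinal b_lt).
have : (3 * (n ^ 2).+1 < 2 * n`!)%N.
  elim: n n_ge {alg alg_ok G t t_q t_ok s g run_g answer few} => // m IH.
  rewrite leq_eqVlt => /orP[/eqP[<-] //|m_ge]; have := IH m_ge.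
  by rewrite factS -!mulnn; nia.
by have := leq_trans t_ok (leq_mul (leqnn 3) few); rewrite card_Sn; lia.
Qed.

Lemma fas_size_t_two_queries (R : realType) (n q : nat) (eps alpha : R)
    (d : measure_display) (Omega : measurableType d) (P : probability Omega R)
    (alg : Omega -> strategy R n int) :
  (7 <= n)%N -> 0 <= eps -> query_algorithm q eps (fas_size_t alpha) P alg ->
  (2 <= q)%N.
Proof.
case: n alg => // n alg n_ge eps_ge0 alg_ok.
rewrite leqNgt ltnS; apply/negP => q_le1.
pose G (i : bool * 'S_n.+1) := relabel (@induced (arcs i.1) n.+1) i.2.
have [t [t_q t_ok]] := derandomize alg_ok
  (fun i : bool * 'S_n.+1 => tournament_arcs i.1 i.2)
  (fun i => exact_eps_oracle (G i) eps_ge0).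
have [s [g run_g]] := run_one_query (fun i => leq_trans (t_q i) q_le1).
(* The strategy reduces to a test on one count, where [h] means a claim of acyclicity. *)
pose h (b : nat) := g b%:R == 0.
have n_ge3 : (3 <= n.+1)%N by apply: leq_trans n_ge.
have few : (\sum_i `[< fas_size_t alpha (G i) (run (fun s => #|back_arcs (G i) s|%:R) t) >]
    <= n`! * (n + 3))%N.
  apply: leq_trans (sum_back_arcs_flip h _); last by rewrite -ltnS (leq_trans _ n_ge).
  rewrite -(sum_relabel _ (fun b => h b) s) -(sum_relabel _ (fun b => ~~ h b) s).
  rewrite addnC -(pair_bigA _ (fun f p => nat_of_bool `[< fas_size_t alpha (G (f, p))
    (run (fun s => #|back_arcs (G (f, p)) s|%:R) t) >])) big_bool.
  apply: leq_add; apply: leq_sum => p _; case: asboolP => // /(fas_size_t_arcs n_ge3).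
    by rewrite run_g /h => ->.
  by rewrite run_g /h => ->.
(* Success would require [4 * (n + 1) <= 3 * (n + 3)], false from [n = 6] on, that is, for 7 or more
   vertices. *)
have := leq_trans t_ok (leq_mul (leqnn 3) few).
rewrite card_prod card_bool card_Sn factS.
by have := fact_gt0 n; nia.
Qed.

Lemma query_lower_bound (R : realType) (n q : nat) (eps : R) :
  (7 <= n)%N -> 0 <= eps -> (2 <= q)%N ->
  (forall a K : R, (forall f, (\sum_(s : 'S_n)
      ~~ admissible eps a #|back_arcs (@induced (arcs f) n) s|%:R)%:R <= K) ->
    n`!%:R <= 6 * (q%:R * K)) ->
  expR (3072^-1 * eps ^+ 2 * n%:R) <= q%:R.
Proof.
move=> n_ge e0 q_ge bound.
have fact_gt : 0 < n`!%:R :> R by rewrite ltr0n fact_gt0.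
have [e1|e1] := leP eps 1; last first.
  (* For [eps > 1] the answer 0 is always legal, so [K = 0] is allowed and [bound] becomes
     absurd. *)
  have := bound 0 0; rewrite !mulr0 leNgt fact_gt => /(_ _)/negP; case=> // f.
  rewrite big1 // => s _; rewrite /admissible; apply/eqP; rewrite eqb0 negbK.
  have : 0 <= #|back_arcs (@induced (arcs f) n) s|%:R :> R by [].
  by move: #|_|%:R => b b0; apply/andP; split; nra.
have n_ge3 : (3 <= n)%N by apply: leq_trans n_ge.
have := bound _ _ (fun f => sum_inadmissible (@sink_arcs f) n_ge3 e0 e1).
set x := eps ^+ 2 * n%:R; rewrite expRN => le24.
have exp_gt0 := expR_gt0 (x / 512).
have {}le24 : expR (x / 512) <= 24 * q%:R.
  move: le24.
  have -> : 6 * (q%:R * (4 * n`!%:R * (expR (x / 512))^-1))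
      = n`!%:R * (24 * q%:R / expR (x / 512)) by ring.
  by rewrite -[leLHS]mulr1 ler_pM2l // ler_pdivlMr // mul1r.
have q2 : (2 : R) <= q%:R by rewrite ler_nat.
(* Since [q >= 2], the factor 24 is at most [q ^+ 5]; taking sixth roots turns 512 into 3072. *)
rewrite -(ler_pXn2r (_ : 0 < 6)%N) ?nnegrE ?expR_ge0 //.
rewrite -expRM_natr (_ : _ * 6 = x / 512); last by rewrite /x; field.
apply: (le_trans le24); rewrite exprSr ler_wpM2r //.
rewrite (le_trans (_ : 24 <= 2 ^+ 5)) ?ler_pXn2r ?nnegrE //.
by rewrite -natrX ler_nat.
Qed.

Theorem theorem3p12 (R : realType) :
  exists (c : R) (n0 : nat), 0 < c /\
    forall (n q : nat) (eps alpha : R),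
      (n0 <= n)%N -> 0 <= eps -> 1 <= alpha ->
      forall (d : measure_display) (Omega : measurableType d)
             (P : probability Omega R),
        (forall alg : Omega -> strategy R n 'S_n,
           query_algorithm q eps (fas_t alpha) P alg ->
           expR (c * eps ^+ 2 * n%:R) <= q%:R) /\
        (forall alg : Omega -> strategy R n int,
           query_algorithm q eps (fas_size_t alpha) P alg ->
           expR (c * eps ^+ 2 * n%:R) <= q%:R).
Proof.
exists 3072^-1, 7%N; split; first by rewrite invr_gt0 (ltr0n R 3072).
move=> n q eps alpha n_ge e0 _ d Omega P; split=> alg alg_ok.
- apply: (query_lower_bound n_ge e0 (fas_t_two_queries n_ge e0 alg_ok)).
  by move=> a K; apply: fas_t_lazy_bound n_ge e0 alg_ok.
- apply: (query_lower_bound n_ge e0 (fas_size_t_two_queries n_ge e0 alg_ok)).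
  by move=> a K; apply: fas_size_t_lazy_bound n_ge e0 alg_ok.
Qed.
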